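(* Let $\mathcal{X}\subset\mathbb{R}^d$ be nonempty, convex and compact with diameter at most $D$ (i.e. $\|\mathbf{x}-\mathbf{y}\|\le D$ for all $\mathbf{x},\mathbf{y}\in\mathcal{X}$), and let $f:\mathcal{X}\to\mathbb{R}$ be convex and differentiable with $L$-Lipschitz gradient on $\mathcal{X}$, $L>0$, i.e. $\|\nabla f(\mathbf{x})-\nabla f(\mathbf{y})\|_*\le L\|\mathbf{x}-\mathbf{y}\|$ for all $\mathbf{x},\mathbf{y}\in\mathcal{X}$. Run Frank-Wolfe with heavy ball momentum (HFW) with, for all $k\ge 0$, $$\delta_k=\frac{2}{k+2},\qquad \eta_k=\max\Big\{0,\min\Big\{\frac{\langle\nabla f(\mathbf{x}_k),\mathbf{x}_k-\mathbf{v}_{k+1}\rangle}{L\|\mathbf{v}_{k+1}-\mathbf{x}_k\|^2},1\Big\}\Big\}.$$ Then the generalized FW gap satisfies $$\mathcal{G}_k=f(\mathbf{x}_k)-\Phi_k(\mathbf{v}_k)\le\frac{2LD^2}{k+1},\qquad\forall k\ge 1.$$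
   Context: $\|\cdot\|$ is a norm on $\mathbb{R}^d$, $\|\cdot\|_*$ its dual norm, $\langle\cdot,\cdot\rangle$ the inner product. HFW with parameters $\delta_k,\eta_k\in[0,1]$: start from any $\mathbf{x}_0\in\mathcal{X}$ and $\mathbf{g}_0=\nabla f(\mathbf{x}_0)$; for $k=0,1,2,\dots$ set $\mathbf{g}_{k+1}=(1-\delta_k)\mathbf{g}_k+\delta_k\nabla f(\mathbf{x}_k)$, let $\mathbf{v}_{k+1}$ be any element of $\arg\min_{\mathbf{v}\in\mathcal{X}}\langle\mathbf{g}_{k+1},\mathbf{v}\rangle$, and set $\mathbf{x}_{k+1}=(1-\eta_k)\mathbf{x}_k+\eta_k\mathbf{v}_{k+1}$. If $\mathbf{v}_{k+1}=\mathbf{x}_k$ the fraction in $\eta_k$ is undefined and $\eta_k$ is any number in $[0,1]$ (then $\mathbf{x}_{k+1}=\mathbf{x}_k$ regardless). Weights: $w_k^\tau=\delta_\tau\prod_{j=\tau+1}^k(1-\delta_j)$ for $1\le\tau\le k$ and $w_k^0=\prod_{j=1}^k(1-\delta_j)$ (empty products equal $1$), so that $\mathbf{g}_{k+1}=\sum_{\tau=0}^k w_k^\tau\nabla f(\mathbf{x}_\tau)$. For $k\ge 0$ define $$\Phi_{k+1}(\mathbf{x})=\sum_{\tau=0}^k w_k^\tau\big[f(\mathbf{x}_\tau)+\langle\nabla f(\mathbf{x}_\tau),\mathbf{x}-\mathbf{x}_\tau\rangle\big].$$ The generalized FW gap is, for $k\ge 1$, $\mathcal{G}_k=f(\mathbf{x}_k)-\min_{\mathbf{x}\in\mathcal{X}}\Phi_k(\mathbf{x})=f(\mathbf{x}_k)-\Phi_k(\mathbf{v}_k)$.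 *)

(* Defs.v *)
From mathcomp Require Export all_boot all_order all_algebra.
From mathcomp Require Export all_classical all_reals all_analysis.

Set Implicit Arguments.
Unset Strict Implicit.
Unset Printing Implicit Defensive.

Export Order.TTheory GRing.Theory Num.Theory.
Export numFieldNormedType.Exports.

Local Open Scope classical_set_scope.
Local Open Scope ring_scope.

Definition dot (R : realType) (d : nat) (u v : 'rV[R]_d) : R :=
  \sum_(i < d) u 0 i * v 0 i.

(* An arbitrary norm on R^d. The sup norm `|x| of 'rV[R]_d is used only for its
   topology, which is the topology of every norm. *)
Record is_norm (R : realType) (d : nat) (N : 'rV[R]_d -> R) : Prop := IsNorm {
  is_norm_triangle : forall x y, N (x + y) <= N x + N y;
  is_norm_scale : forall (a : R) x, N (a *: x) = `|a| * N x;
  is_norm_eq0 : forall x, N x = 0 -> x = 0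
}.

Definition dual_norm (R : realType) (d : nat) (N : 'rV[R]_d -> R)
    (g : 'rV[R]_d) : R :=
  sup [set dot g u | u in [set u | N u <= 1]].

(* f is defined on X only, so differentiability at x is along points of X:
   f y = f x + <g, y - x> + o(y - x) as y -> x with y in X. Where X is flat
   this leaves g undetermined in the directions orthogonal to X. *)
Definition is_gradient_within (R : realType) (d : nat) (X : set 'rV[R]_d)
    (f : 'rV[R]_d -> R) (x g : 'rV[R]_d) : Prop :=
  let F := within X (nbhs x) in
  (fun y => f y - f x - dot g (y - x) : R^o) =o_F (fun y => y - x).

Definition argmin (R : realType) (T : Type) (X : set T) (F : T -> R) : set T :=
  [set v | X v /\ forall u, X u -> F v <= F u].

(* v 0 is unused: the first linear minimization produces v 1. *)
Record hfw (R : realType) (d : nat) (X : set 'rV[R]_d)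
    (gradf : 'rV[R]_d -> 'rV[R]_d) (delta eta : nat -> R)
    (x g v : nat -> 'rV[R]_d) : Prop := Hfw {
  hfw_delta01 : forall k, 0 <= delta k <= 1;
  hfw_eta01 : forall k, 0 <= eta k <= 1;
  hfw_x0 : X (x 0%N);
  hfw_g0 : g 0%N = gradf (x 0%N);
  hfw_g : forall k,
    g k.+1 = (1 - delta k) *: g k + delta k *: gradf (x k);
  hfw_v : forall k, argmin X (dot (g k.+1)) (v k.+1);
  hfw_x : forall k, x k.+1 = (1 - eta k) *: x k + eta k *: v k.+1
}.

(* Guarded because the fraction is undefined when v k.+1 = x k; then eta k is
   subject only to hfw_eta01. *)
Definition smart_step (R : realType) (d : nat) (N : 'rV[R]_d -> R) (L : R)
    (gradf : 'rV[R]_d -> 'rV[R]_d) (eta : nat -> R)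
    (x v : nat -> 'rV[R]_d) : Prop :=
  forall k, v k.+1 != x k ->
    eta k = Num.max 0 (Num.min
      (dot (gradf (x k)) (x k - v k.+1) / (L * N (v k.+1 - x k) ^+ 2)) 1).

(* weight delta k tau is w_k^tau *)
Definition weight (R : realType) (delta : nat -> R) (k tau : nat) : R :=
  if tau is 0%N then \prod_(1 <= j < k.+1) (1 - delta j)
  else delta tau * \prod_(tau.+1 <= j < k.+1) (1 - delta j).

(* Phi_k for k >= 1, i.e. the sum over 0 <= tau <= k - 1 with weights
   w_(k-1)^tau; Phi 0 is a junk value. *)
Definition Phi (R : realType) (d : nat) (f : 'rV[R]_d -> R)
    (gradf : 'rV[R]_d -> 'rV[R]_d) (delta : nat -> R) (x : nat -> 'rV[R]_d)
    (k : nat) (y : 'rV[R]_d) : R :=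
  \sum_(0 <= tau < k) weight delta k.-1 tau *
    (f (x tau) + dot (gradf (x tau)) (y - x tau)).

(* The minimum over X, written as an infimum; it is attained since X is
   compact and nonempty. *)
Definition gap (R : realType) (d : nat) (X : set 'rV[R]_d)
    (f : 'rV[R]_d -> R) (gradf : 'rV[R]_d -> 'rV[R]_d) (delta : nat -> R)
    (x : nat -> 'rV[R]_d) (k : nat) : R :=
  f (x k) - inf [set Phi f gradf delta x k y | y in X].

(* Main.v *)
(* Since delta 0 = 1, Phi k.+1 is the (1 - delta k, delta k)-average of Phi k
   and of the linearization of f at x k; it is affine with slope g k.+1, so
   v k.+1 minimizes it over X. The step eta k minimizes the quadratic upper
   bound of f on the segment from x k to v k.+1, so that bound may be evaluated
   at delta k instead, which gives
     G (k+1) <= (1 - delta k) G k + L D^2 (delta k)^2 / 2,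
   and the rate follows by induction. *)
Require Import Defs.
From mathcomp Require Import ring lra.

Set Implicit Arguments.
Unset Strict Implicit.
Unset Printing Implicit Defensive.

Local Open Scope classical_set_scope.
Local Open Scope ring_scope.

(** * Bilinearity of the inner product and its bound by the sup norm *)

Lemma dotDl (R : realType) (d : nat) (u w y : 'rV[R]_d) :
  dot (u + w) y = dot u y + dot w y.
Proof.
by rewrite /dot -big_split; apply: eq_bigr => i _; rewrite mxE mulrDl.
Qed.

Lemma dotDr (R : realType) (d : nat) (y u w : 'rV[R]_d) :
  dot y (u + w) = dot y u + dot y w.
Proof.
by rewrite /dot -big_split; apply: eq_bigr => i _; rewrite mxE mulrDr.
Qed.

Lemma dotZl (R : realType) (d : nat) (a : R) (u y : 'rV[R]_d) :
  dot (a *: u) y = a * dot u y.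
Proof.
by rewrite /dot big_distrr /=; apply: eq_bigr => i _; rewrite mxE mulrA.
Qed.

Lemma dotZr (R : realType) (d : nat) (a : R) (y u : 'rV[R]_d) :
  dot y (a *: u) = a * dot y u.
Proof.
by rewrite /dot big_distrr /=; apply: eq_bigr => i _; rewrite mxE mulrCA.
Qed.

Lemma dotBl (R : realType) (d : nat) (u w y : 'rV[R]_d) :
  dot (u - w) y = dot u y - dot w y.
Proof. by rewrite -scaleN1r dotDl dotZl mulN1r. Qed.

Lemma dotBr (R : realType) (d : nat) (y u w : 'rV[R]_d) :
  dot y (u - w) = dot y u - dot y w.
Proof. by rewrite -scaleN1r dotDr dotZr mulN1r. Qed.

Lemma ler_entry_norm (R : realType) (d : nat) (u : 'rV[R]_d) (i : 'I_d) :
  `|u 0 i| <= `|u|.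
Proof.
rewrite [leRHS]/Num.norm /= mx_normrE.
by apply/bigmax_geP; right => /=; exists (0, i).
Qed.

Lemma ler_dot_norm (R : realType) (d : nat) (g u : 'rV[R]_d) :
  dot g u <= (\sum_(i < d) `|g 0 i|) * `|u|.
Proof.
rewrite big_distrl /=; apply: ler_sum => i _.
by rewrite (le_trans (ler_norm _))// normrM ler_wpM2l// ler_entry_norm.
Qed.

(** * Arbitrary norms on R^d: comparison with the sup norm, and duality *)

Lemma is_norm0 (R : realType) (d : nat) (N : 'rV[R]_d -> R) : is_norm N ->
  N 0 = 0.
Proof. by case=> _ NZ _; rewrite -[0 : 'rV_d](scale0r 0) NZ normr0 mul0r. Qed.

Lemma is_normN (R : realType) (d : nat) (N : 'rV[R]_d -> R) (u : 'rV[R]_d) :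
  is_norm N -> N (- u) = N u.
Proof. by case=> _ NZ _; rewrite -scaleN1r NZ normrN1 mul1r. Qed.

Lemma is_norm_ge0 (R : realType) (d : nat) (N : 'rV[R]_d -> R) (u : 'rV[R]_d) :
  is_norm N -> 0 <= N u.
Proof.
move=> hN; have := is_norm_triangle hN u (- u).
by rewrite subrr is_norm0// is_normN// -mulr2n pmulrn_lge0.
Qed.

Lemma is_norm_gt0 (R : realType) (d : nat) (N : 'rV[R]_d -> R) (u : 'rV[R]_d) :
  is_norm N -> u != 0 -> 0 < N u.
Proof.
move=> hN u0; rewrite lt_neqAle is_norm_ge0// andbT eq_sym.
by apply: contra_neq u0; exact: is_norm_eq0 hN _.
Qed.

Lemma norm_le_sup_norm (R : realType) (d : nat) (N : 'rV[R]_d -> R) :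
  is_norm N -> exists C, forall u, N u <= C * `|u|.
Proof.
move=> hN; exists (\sum_(i < d) N (delta_mx 0 i)) => u.
rewrite {1}[u]row_sum_delta big_distrl /=.
elim/big_ind2 : _ => [|y a z b ya zb|i _].
- by rewrite is_norm0.
- by rewrite (le_trans (is_norm_triangle hN _ _))// lerD.
- by rewrite (is_norm_scale hN) mulrC ler_wpM2l ?is_norm_ge0// ler_entry_norm.
Qed.

(** The reverse triangle inequality and the comparison above make [N] Lipschitz for the sup norm. *)
Lemma is_norm_continuous (R : realType) (d : nat) (N : 'rV[R]_d -> R) :
  is_norm N -> continuous N.
Proof.
move=> hN y; have [C NC] := norm_le_sup_norm hN.
have NB u w : N u - N w <= (`|C| + 1) * `|w - u|.
  rewrite lerBlDr -{1}(subrK w u) (le_trans (is_norm_triangle hN _ _))// lerD2r.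
  rewrite (le_trans (NC _))// distrC ler_wpM2r//.
  by rewrite (le_trans (ler_norm C))// lerDl.
apply/(@cvgrPdist_le R R^o _ (nbhs y) (nbhs_filter y)) => e e0.
have C0 : 0 < `|C| + 1 by rewrite ltr_wpDl.
have yC : \forall z \near y, `|y - z| <= e / (`|C| + 1).
  apply: (@cvgr_dist_le R _ _ (nbhs y) (nbhs_filter y) id y cvg_id).
  by rewrite divr_gt0.
apply: filterS yC => z; rewrite ler_pdivlMr// mulrC => yz.
rewrite ler_norml lerNl opprB.
by rewrite !(le_trans (NB _ _))// distrC.
Qed.

(** The constant is the minimum of [N] on the sup-norm unit sphere: it is attained by compactness,
    positive because 0 is not on the sphere, and homogeneity extends the bound to all vectors. *)
Lemma sup_norm_le_norm (R : realType) (d : nat) (N : 'rV[R]_d -> R) :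
  is_norm N -> exists2 c, 0 < c & forall u, c * `|u| <= N u.
Proof.
move=> hN; have [[w w0]|triv] :=
  (* When 0 is the only vector the sphere is empty and has no minimum; any constant works. *)
  pselect (exists w : 'rV[R]_d, w != 0); last first.
  exists 1 => // u; have [->|u0] := eqVneq u 0.
    by rewrite normr0 mulr0 is_norm0.
  by case: triv; exists u.
pose S := [set u : 'rV[R]_d | `|u| = 1].
have unitS u : u != 0 -> S (`|u|^-1 *: u).
  by move=> u0; rewrite /S /= normrZ normfV normr_id mulVf// normr_eq0.
have S0 : S !=set0 by exists (`|w|^-1 *: w); exact: unitS.
have cS : compact S.
  apply: bounded_closed_compact.
    by exists 1; split; [exact: num_real|move=> M M1 u /= ->; exact: ltW].
  rewrite (_ : S = (fun u : 'rV[R]_d => `|u|) @^-1` [set 1])//.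
  apply: preimage_closed => [u _|]; first exact: norm_continuous.
  exact: closed_eq.
have [c /set_mem Sc cmin] :=
  EVT_min_rV S0 cS (continuous_subspaceT (is_norm_continuous hN)).
exists (N c).
  apply: is_norm_gt0 => //; apply/eqP => c0.
  by move: Sc; rewrite /S /= c0 normr0 => /esym/eqP; rewrite oner_eq0.
move=> u; have [->|u0] := eqVneq u 0; first by rewrite normr0 mulr0 is_norm0.
have := cmin _ (mem_set (unitS _ u0)).
rewrite (is_norm_scale hN) normfV normr_id mulrC ler_pdivlMr//.
by rewrite normr_gt0.
Qed.

Lemma dot_le_dual_norm (R : realType) (d : nat) (N : 'rV[R]_d -> R)
    (g u : 'rV[R]_d) : is_norm N -> dot g u <= dual_norm N g * N u.
Proof.
move=> hN; have [->|u0] := eqVneq u 0.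
  by rewrite (is_norm0 hN) mulr0 -[0 : 'rV_d](scale0r 0) dotZr mul0r.
have Nu := is_norm_gt0 hN u0.
have [c c0 cN] := sup_norm_le_norm hN.
rewrite -ler_pdivrMr// mulrC -dotZr; apply: ub_le_sup.
  (* [dual_norm] is a real-valued [sup], meaningful only for a bounded set; the [N]-unit ball lies
     in the sup-norm ball of radius [c^-1], which gives this bound. *)
  exists ((\sum_(i < d) `|g 0 i|) * c^-1) => _ [w /= Nw <-].
  apply: le_trans (ler_dot_norm g w) _; apply: ler_wpM2l.
    by apply: sumr_ge0.
  by rewrite -(ler_pM2l c0) divff ?gt_eqF// (le_trans (cN w)).
exists ((N u)^-1 *: u) => //=.
by rewrite (is_norm_scale hN) gtr0_norm ?invr_gt0// mulVf// gt_eqF.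
Qed.

(** * Calculus along segments and the quadratic upper bound *)

(** The expansion is assumed only inside [0, 1], as differentiability within a convex set provides.
    It yields two-sided derivatives in the interior and continuity up to the endpoints, which
    suffices for the mean value theorem. *)
Lemma mean_value_within (R : realType) (p m : R -> R) :
  (forall t : R, 0 <= t <= 1 -> forall e : R, 0 < e ->
     \forall s \near t, 0 <= s <= 1 ->
       `|p s - p t - (s - t) * m t| <= e * `|s - t|) ->
  exists2 c, 0 <= c <= 1 & p 1 - p 0 = m c.
Proof.
move=> pm.
have [t t01||c] := @MVT_segment R p m 0 1 ler01.
- move: t01; rewrite in_itv/= => /andP[t0 t1].
  have lim : h^-1 *: ((p \o shift t) (h *: (1 : R)) - p t) @[h --> 0^'] --> m t.
    apply/cvgrPdistC_le => e e0.
    have t01 : 0 <= t <= 1 by rewrite !ltW.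
    have := pm t t01 e e0; rewrite (near_shift 0) subr0 => pt.
    have nt : \forall h \near (0 : R), 0 <= h + t <= 1.
      have := near_in_itvoo (_ : t \in `]0, 1[).
      rewrite in_itv/= t0 t1 => /(_ isT).
      rewrite (near_shift 0) subr0; apply: filterS => h /=.
      by rewrite in_itv/= => /andP[h0 h1]; rewrite !ltW.
    rewrite near_withinE; apply: filterS2 pt nt => h /= pt nt h0.
    have h1 : 0 < `|h| by rewrite normr_gt0.
    rewrite -(ler_pM2l h1) -normrM.
    rewrite /GRing.scale/= mulr1 mulrBr mulrA mulfV// mul1r.
    by have := pt nt; rewrite addrK mulrC [_ * e]mulrC.
  by apply: DeriveDef; [apply/cvg_ex; exists (m t)|exact: cvg_lim].
- apply/subspace_continuousP => t; rewrite /= in_itv/= => t01.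
  apply/cvgrPdistC_le => e e0; rewrite near_withinE.
  have C0 : 0 < 1 + `|m t| by rewrite ltr_pwDl.
  have ts : \forall s \near t, `|s - t| <= e / (1 + `|m t|).
    apply: (@cvgr_distC_le R R^o _ (nbhs t) (nbhs_filter t) id t cvg_id).
    by rewrite divr_gt0.
  apply: filterS2 (pm t t01 1 ltr01) ts => s pt ts /=.
  rewrite in_itv/= => /pt {}pt.
  rewrite -(subrK ((s - t) * m t) (p s - p t)) (le_trans (ler_normD _ _))//.
  rewrite -(divfK (lt0r_neq0 C0) e) (le_trans _ (ler_wpM2r (ltW C0) ts))//.
  by rewrite mulrDr mulr1 lerD// ?normrM// -[leRHS]mul1r.
- by rewrite in_itv/= subr0 mulr1 => c01 ->; exists c.
Qed.

Lemma convex_set_segment (R : realType) (d : nat) (X : set 'rV[R]_d)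
    (x y : 'rV[R]_d) (t : R) :
  convex_set X -> X x -> X y -> 0 <= t <= 1 -> X ((1 - t) *: x + t *: y).
Proof.
move=> cX Xx Xy /andP[t0 t1].
rewrite addrC.
exact: set_mem (cX y x (Itv01 t0 t1) (mem_set Xy) (mem_set Xx)).
Qed.

(** Chain rule along a line. The little-o is used with [e / (1 + |u|)], so that [u = 0] needs no
    separate case. *)
Lemma gradient_within_segment (R : realType) (d : nat) (X : set 'rV[R]_d)
    (f : 'rV[R]_d -> R) (x u g : 'rV[R]_d) (t : R) :
  is_gradient_within X f (x + t *: u) g -> forall e : R, 0 < e ->
  \forall s \near t, X (x + s *: u) ->
    `|f (x + s *: u) - f (x + t *: u) - (s - t) * dot g u| <= e * `|s - t|.
Proof.
move=> fg e e0; have u0 : 0 < 1 + `|u| by rewrite ltr_pwDl.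
have /eqoP/(_ _ (divr_gt0 e0 u0)) := fg; rewrite near_withinE => fz.
have cont : (x + s *: u) @[s --> t] --> x + t *: u.
  by apply: cvgD; [exact: cvg_cst|apply: cvgZr_tmp; exact: cvg_id].
have := cont _ fz; rewrite /= nbhs_filterE.
apply: (@filterS _ (nbhs t)) => s /= + Xs => /(_ Xs).
have -> : x + s *: u - (x + t *: u) = (s - t) *: u.
  by rewrite opprD addrACA subrr add0r scalerBl.
rewrite dotZr normrZ => /le_trans; apply.
rewrite mulrCA mulrC ler_wpM2r// mulrAC ler_pdivrMr// ler_pM2l//.
by rewrite lerDr.
Qed.

(** The gap between [f] and its quadratic model is a function of one variable on the segment; the
    mean value theorem applies, and the Lipschitz bound with duality makes the derivative
    nonpositive. No integral is involved. *)
Lemma descent_lemma (R : realType) (d : nat) (N : 'rV[R]_d -> R)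
    (X : set 'rV[R]_d) (f : 'rV[R]_d -> R) (gradf : 'rV[R]_d -> 'rV[R]_d)
    (L : R) (x y : 'rV[R]_d) :
  is_norm N -> convex_set X ->
  (forall z, X z -> is_gradient_within X f z (gradf z)) ->
  (forall z w, X z -> X w ->
    dual_norm N (gradf z - gradf w) <= L * N (z - w)) ->
  X x -> X y ->
  f y <= f x + dot (gradf x) (y - x) + L / 2 * N (y - x) ^+ 2.
Proof.
move=> hN cX fdiff flip Xx Xy; set u := y - x.
have Xt t : 0 <= t <= 1 -> X (x + t *: u).
  move=> /(convex_set_segment cX Xx Xy); congr X.
  by rewrite /u scalerBl scalerBr scale1r -addrA; congr (_ + _); rewrite addrC.
have [K KE] : exists K, K = L * N u ^+ 2 by eexists.
have [|c c01] := @mean_value_within R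
  (fun t => f (x + t *: u) - t * dot (gradf x) u - K / 2 * t ^+ 2)
  (fun t => dot (gradf (x + t *: u)) u - dot (gradf x) u - K * t).
  move=> t t01 e e0; have e2 : 0 < e / 2 by rewrite divr_gt0.
  have K0 : 0 < `|K| + 1 by rewrite ltr_wpDl.
  (* Half of [e] pays for the remainder of [f], half for that of the quadratic term,
     [K / 2 * (s - t) ^+ 2]. *)
  have ts : \forall s \near t, `|s - t| <= e / (`|K| + 1).
    apply: (@cvgr_distC_le R R^o _ (nbhs t) (nbhs_filter t) id t cvg_id).
    by rewrite divr_gt0.
  have := gradient_within_segment (fdiff _ (Xt _ t01)) e2.
  move=> fs; apply: filterS2 ts fs => s + + s01 => + /(_ (Xt _ s01)).
  rewrite ler_pdivlMr// => ts fs.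
  set a := (X in `|X| <= _) in fs.
  have -> : f (x + s *: u) - s * dot (gradf x) u - K / 2 * s ^+ 2 -
    (f (x + t *: u) - t * dot (gradf x) u - K / 2 * t ^+ 2) -
    (s - t) * (dot (gradf (x + t *: u)) u - dot (gradf x) u - K * t) =
    a - K / 2 * (s - t) ^+ 2 by rewrite /a; field.
  rewrite (le_trans (ler_normB _ _))// [e in leRHS]splitr mulrDl lerD//.
  rewrite expr2 !normrM [`|2^-1|]ger0_norm ?invr_ge0// mulrA ler_wpM2r//.
  rewrite mulrAC ler_wpM2r ?invr_ge0// (le_trans _ ts)// mulrC ler_wpM2l//.
  by rewrite lerDl.
have [c0 c1] := andP c01.
rewrite !scale1r scale0r addr0 expr0n expr1n /= mulr0 mul0r !subr0 mulr1 mul1r.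
have -> : x + u = y by rewrite /u addrC subrK.
rewrite -dotBl => fE.
have := dot_le_dual_norm (gradf (x + c *: u) - gradf x) u hN.
have := flip _ _ (Xt _ c01) Xx.
have -> : x + c *: u - x = c *: u by rewrite addrAC subrr add0r.
rewrite (is_norm_scale hN) (ger0_norm c0).
move=> /(ler_wpM2r (is_norm_ge0 u hN)) dN /le_trans /(_ dN).
have -> : L * (c * N u) * N u = K * c by rewrite KE; ring.
rewrite -/u; move: fE; rewrite KE. lra.
Qed.

(** * The step size, and the averaged linear models with their minima *)

(** [e] is the projection onto [0, 1] of the vertex [a / M] of a convex parabola, hence its
    minimizer there; the cases locate the vertex. *)
Lemma clipped_step_optimal (R : realType) (a M e t : R) :
  0 < M -> e = Num.max 0 (Num.min (a / M) 1) -> 0 <= t <= 1 ->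
  M / 2 * e ^+ 2 - e * a <= M / 2 * t ^+ 2 - t * a.
Proof.
move=> M0 eE /andP[t0 t1]; set q := a / M in eE.
have -> : a = M * q by rewrite /q mulrC divfK// gt_eqF.
suff H : e ^+ 2 / 2 - e * q <= t ^+ 2 / 2 - t * q.
  by have := ler_wpM2l (ltW M0) H; lra.
move: eE; rewrite minEle; case: (leP q 1) => q1; rewrite maxEle.
  case: (leP 0 q) => q0 ->.
    by have := sqr_ge0 (t - q); nra.
  by have := mulr_ge0 t0 (ltW (_ : 0 < - q)); rewrite oppr_gt0; nra.
rewrite ler01 => ->; nra.
Qed.

(** Raising [k] multiplies every old weight by [1 - delta k]. The condition on [delta 0] settles
    [k = 0], where the only weight is an empty product. *)
Lemma PhiS (R : realType) (d : nat) (f : 'rV[R]_d -> R)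
    (gradf : 'rV[R]_d -> 'rV[R]_d) (delta : nat -> R) (x : nat -> 'rV[R]_d)
    (k : nat) (y : 'rV[R]_d) : delta 0%N = 1 ->
  Phi f gradf delta x k.+1 y = (1 - delta k) * Phi f gradf delta x k y +
    delta k * (f (x k) + dot (gradf (x k)) (y - x k)).
Proof.
move=> d0; rewrite /Phi big_nat_recr//=; congr (_ + _ * _); last first.
  by case: k => [|k]; rewrite /weight big_geq// mulr1.
case: k => [|k]; first by rewrite !big_geq// mulr0.
rewrite big_distrr/=; apply: eq_big_nat => tau /andP[_ tauk]; rewrite mulrA.
congr (_ * _); rewrite mulrC /weight.
by case: tau tauk => [|tau] tauk; rewrite big_nat_recr//= mulrA.
Qed.

(** The slopes of [Phi] and the vectors [g] obey the same recursion; [delta 0 = 1] erases [g 0] and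
    starts both at [gradf (x 0)]. *)
Lemma Phi_affine (R : realType) (d : nat) (f : 'rV[R]_d -> R)
    (gradf : 'rV[R]_d -> 'rV[R]_d) (delta : nat -> R) (x g : nat -> 'rV[R]_d) :
  delta 0%N = 1 ->
  (forall k, g k.+1 = (1 - delta k) *: g k + delta k *: gradf (x k)) ->
  forall k y z, Phi f gradf delta x k.+1 y - Phi f gradf delta x k.+1 z =
    dot (g k.+1) (y - z).
Proof.
move=> d0 gS; elim=> [|k IH] y z.
  rewrite !PhiS// gS d0 subrr scale0r add0r scale1r !mul0r !add0r !mul1r.
  by rewrite !dotBr; ring.
rewrite PhiS// [in X in _ - X]PhiS// gS dotDl !dotZl -IH !dotBr; ring.
Qed.

Lemma inf_argmin (R : realType) (T : Type) (X : set T) (F : T -> R) (v : T) :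
  argmin X F v -> inf [set F u | u in X] = F v.
Proof.
move=> [Xv vmin]; apply/eqP; rewrite eq_le; apply/andP; split.
  by apply: ge_inf; [exists (F v) => _ [u Xu <-]; exact: vmin|exists v].
by apply: lb_le_inf; [exists (F v), v|move=> _ [u Xu <-]; exact: vmin].
Qed.

(** * The gap recursion and its rate *)

Theorem theorem2 (R : realType) (d : nat) (N : 'rV[R]_d -> R) (hN : is_norm N)
  (X : set 'rV[R]_d) (X_neq0 : X !=set0) (X_convex : convex_set X)
  (X_compact : compact X) (D : R)
  (X_diam : forall x y, X x -> X y -> N (x - y) <= D)
  (f : 'rV[R]_d -> R) (gradf : 'rV[R]_d -> 'rV[R]_d)
  (f_convex : convex_function X f)
  (f_diff : forall x, X x -> is_gradient_within X f x (gradf x))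
  (L : R) (L_gt0 : 0 < L)
  (gradf_lip : forall x y, X x -> X y ->
     dual_norm N (gradf x - gradf y) <= L * N (x - y))
  (delta eta : nat -> R) (x g v : nat -> 'rV[R]_d)
  (hdelta : forall k, delta k = 2 / (k%:R + 2))
  (hrun : hfw X gradf delta eta x g v)
  (heta : smart_step N L gradf eta x v) :
  forall k : nat, (1 <= k)%N ->
    gap X f gradf delta x k = f (x k) - Phi f gradf delta x k (v k) /\
    gap X f gradf delta x k <= 2 * L * D ^+ 2 / (k%:R + 1).
Proof.
case: hrun => delta01 eta01 Xx0 _ gS vmin xS.
have delta0 : delta 0%N = 1 by rewrite hdelta add0r divff.
have Xv k : X (v k.+1) by case: (vmin k).
have Xx k : X (x k).
  by elim: k => // k Xxk; rewrite xS; exact: convex_set_segment.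
have vPhi k : argmin X (Phi f gradf delta x k.+1) (v k.+1).
  split=> // u Xu; rewrite -subr_ge0 (Phi_affine _ delta0 gS) dotBr subr_ge0.
  by case: (vmin k) => _; exact.
have gapE k : gap X f gradf delta x k.+1 =
    f (x k.+1) - Phi f gradf delta x k.+1 (v k.+1).
  by rewrite /gap (inf_argmin (vPhi k)).
have step k : f (x k.+1) <= f (x k) +
    delta k * dot (gradf (x k)) (v k.+1 - x k) + L / 2 * D ^+ 2 * delta k ^+ 2.
  (* If the two points coincide, [eta k] is unspecified but the iterate does not move. *)
  have [vx|vx] := eqVneq (v k.+1) (x k).
    rewrite xS vx -scalerDl subrK scale1r subrr -[0 : 'rV_d](scale0r 0) dotZr.
    rewrite mul0r mulr0 addr0 lerDl mulr_ge0 ?sqr_ge0//.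
    by rewrite mulr_ge0 ?sqr_ge0// divr_ge0// ltW.
  have N0 : 0 < N (v k.+1 - x k) by rewrite is_norm_gt0// subr_eq0.
  have M0 : 0 < L * N (v k.+1 - x k) ^+ 2 by rewrite mulr_gt0// exprn_gt0.
  have opt := clipped_step_optimal M0 (heta k vx) (delta01 k).
  have [e0 _] := andP (eta01 k).
  have := descent_lemma hN X_convex f_diff gradf_lip (Xx k) (Xx k.+1).
  have -> : x k.+1 - x k = eta k *: (v k.+1 - x k).
    by rewrite xS scalerBl scale1r scalerBr addrAC [_ - x k]addrAC
      subrr add0r addrC.
  rewrite dotZr (is_norm_scale hN) (ger0_norm e0) exprMn => desc.
  have ND : N (v k.+1 - x k) ^+ 2 <= D ^+ 2.
    by rewrite ler_sqr ?nnegrE ?(le_trans (ltW N0)) ?X_diam.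
  have := ler_wpM2l (_ : 0 <= L / 2 * delta k ^+ 2) ND.
  rewrite mulr_ge0 ?sqr_ge0 ?divr_ge0 ?(ltW L_gt0)// => /(_ isT).
  move: opt desc; rewrite !dotBr; nra.
have rec k : f (x k.+1) - Phi f gradf delta x k.+1 (v k.+1) <=
    (1 - delta k) * (f (x k) - Phi f gradf delta x k (v k)) +
    L / 2 * D ^+ 2 * delta k ^+ 2.
  (* Minimality of [v k] for [Phi k] is available only for positive [k]; at [k = 0] the factor
     [1 - delta 0] vanishes. *)
  have PhiM : (1 - delta k) * Phi f gradf delta x k (v k) <=
      (1 - delta k) * Phi f gradf delta x k (v k.+1).
    case: k => [|k]; first by rewrite delta0 subrr !mul0r.
    have /andP[_ d1] := delta01 k.+1.
    by rewrite ler_wpM2l ?subr_ge0//; case: (vPhi k) => _; exact.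
  rewrite PhiS//; have := step k; move: PhiM; lra.
have D0 : 0 <= L * D ^+ 2 by rewrite mulr_ge0 ?sqr_ge0 ?(ltW L_gt0).
suff bound k : f (x k.+1) - Phi f gradf delta x k.+1 (v k.+1) <=
    2 * L * D ^+ 2 / (k.+1%:R + 1) by case=> // k _; rewrite gapE.
elim: k => [|k IH]; apply: le_trans (rec _) _.
  (* With [delta 0 = 1] the recursion gives [L * D ^+ 2 / 2], half of what is claimed. *)
  have -> : 2 * L * D ^+ 2 / (1%:R + 1) = L * D ^+ 2 by field.
  by rewrite delta0 subrr mul0r add0r expr1n; lra.
have k0 : 0 <= k%:R :> R by [].
have d1 : 0 <= 1 - delta k.+1.
  by have /andP[_] := delta01 k.+1; rewrite subr_ge0.
apply: le_trans (lerD (ler_wpM2l d1 IH) (lexx _)) _.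
rewrite hdelta -(natr1 k.+1) -(natr1 k).
set n : R := k%:R in k0 *; set P := L * D ^+ 2 in D0.
rewrite -subr_ge0.
(* The slack of the induction step in closed form: over the common denominator the numerator is
   [2 * P] times [(n + 3) * (n + 2) - (n + 1) * (n + 3) - (n + 2) = 1]. *)
have -> : 2 * L * D ^+ 2 / (n + 1 + 1 + 1) -
  ((1 - 2 / (n + 1 + 2)) * (2 * L * D ^+ 2 / (n + 1 + 1)) +
   L / 2 * D ^+ 2 * (2 / (n + 1 + 2)) ^+ 2) =
   2 * P / ((n + 3) ^+ 2 * (n + 2)).
  rewrite /P; field; rewrite !lt0r_neq0// ltr_wpDl.
have n2 : 0 <= n + 2 by rewrite addr_ge0.
by apply: divr_ge0; [exact: mulr_ge0|apply: mulr_ge0 => //; exact: sqr_ge0].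
Qed.
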